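(* Let $G$ be a finite group, $p$ a prime, and $P$ a Sylow $p$-subgroup of $G$. Then all irreducible complex characters of $\mathbf N_G(P)$ of degree not divisible by $p$ extend to $G$ if and only if there is a normal subgroup $K\trianglelefteq G$ such that $K\,\mathbf N_G(P)=G$ and $\mathbf N_K(P)=1$.
   Context: $\mathbf N_G(P)$ is the normalizer of $P$ in $G$ and $\mathbf N_K(P)=K\cap \mathbf N_G(P)$. An irreducible character $\tau$ of a subgroup $H\le G$ extends to $G$ if there is a character $\chi$ of $G$ (necessarily irreducible) whose restriction to $H$ equals $\tau$. *)

(* Defs.v *)
From mathcomp Require Import all_boot all_order all_fingroup all_algebra.
From mathcomp Require Import all_solvable all_field all_character.

Set Implicit Arguments.
Unset Strict Implicit.
Unset Printing Implicit Defensive.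

Local Open Scope ring_scope.

(* Meaningful for H \subset G, as 'Res[H] chi is a junk value otherwise.
   Membership in [character] allows chi = 0, but 0 does not restrict to an
   irreducible tau. *)
Definition extends_to (gT : finGroupType) (G H : {group gT}) (tau : 'CF(H)) :=
  exists2 chi : 'CF(G), chi \is a character & 'Res[H] chi = tau.
Arguments extends_to {gT} G%_G {H}%_G tau.

(* Main.v *)
Require Import Defs.
From mathcomp Require Import all_boot all_order all_fingroup all_algebra.
From mathcomp Require Import all_solvable all_field all_character.

Set Implicit Arguments.
Unset Strict Implicit.
Unset Printing Implicit Defensive.

Import GroupScope.

(** Write N = N_G(P).  If K is a normal complement of N in G, then N is a
    quotient of G, and characters of N extend by inflation.

    Conversely, let P' be the derived subgroup of P.  An irreducible character
    of N with P' in its kernel has degree dividing |N : P| by Ito's theorem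
    [Ito_dvd_index], hence prime to p, and so extends to G under the hypothesis.
    If all irreducible characters of N with a given normal subgroup Q of N in
    their kernel extend, then the intersection of the kernels of the extensions
    is a normal subgroup of G meeting N exactly in Q
    [normal_subgroup_of_extensions].  Taking Q = P and Q = P' gives normal
    subgroups L <= M of G with M :&: N = P and L :&: N = P'.

    So P is a self-normalizing Sylow subgroup of M.  It is abelian modulo L and
    is still self-normalizing there, so Burnside's transfer theorem
    [Burnside_normal_complement] gives M / L a normal p-complement X / L.  Then
    M / X is a p-group and X :&: P = L :&: P = P' lies in the Frattini subgroup
    of P; by Tate's theorem [Tate_normal_complement], M itself has a normal
    p-complement K.  As K is characteristic in M, it is normal in G; the
    Frattini argument gives G = M N = K P N = K N; and K :&: N, being contained
    in M :&: N = P, is both a p-group and a p'-group, hence trivial.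

    Tate's theorem is deduced from Gaschutz's splitting theorem, in the form of
    a lifting criterion for homomorphisms [Gaschutz_lift]. *)

(** * Lifting homomorphisms through abelian kernels *)

(** A lift of f through q is a complement to the copy Z of 'ker q in the fibre
    product E of f and q; the partial lift s0 provides such a complement in the
    preimage of P, and Gaschutz's theorem transports the splitting to E. *)
Lemma Gaschutz_lift (gT hT rT : finGroupType)
    (G P : {group gT}) (H : {group hT}) (f : {morphism G >-> rT})
    (q : {morphism H >-> rT}) (s0 : {morphism P >-> hT}) :
    P \subset G -> f @* G \subset q @* H -> s0 @* P \subset H ->
    {in P, forall x, q (s0 x) = f x} ->
    abelian ('ker q) -> coprime #|'ker q| #|G : P| ->
  exists s : {morphism G >-> hT},
    s @* G \subset H /\ {in G, forall x, q (s x) = f x}.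
Proof.
move=> sPG sfGqH ss0H qs0 abK coK.
have gE : group_set
    [set z : gT * hT | [&& z.1 \in G, z.2 \in H & f z.1 == q z.2]].
  apply/group_setP; split=> [|x y].
    by rewrite inE /= !group1 !morph1 eqxx.
  rewrite !inE => /and3P[Gx1 Hx2 /eqP fx] /and3P[Gy1 Hy2 /eqP fy] /=.
  by rewrite !groupM // !morphM // fx fy eqxx.
pose E := Group gE.
have memE z : z \in E -> [/\ z.1 \in G, z.2 \in H & f z.1 = q z.2].
  by rewrite inE => /and3P[Gz Hz /eqP].
have fstE : fst @* E = G.
  apply/setP=> x; apply/morphimP/idP=> [[z _] | Gx].
    by case/memE=> Gz _ _ ->.
  have /morphimP[h Hh _ fx]: f x \in q @* H.
    by apply: (subsetP sfGqH); apply: mem_morphim.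
  by exists (x, h); rewrite ?inE //= Gx Hh fx eqxx.
pose Z := 'ker_E (fst : gT * hT -> gT).
have defZ : Z = @pair1g gT hT @* ('ker q).
  rewrite morphim_pair1g; apply/setP=> -[x h]; rewrite !inE /=.
  apply/andP/andP=> [[/and3P[_ Hh fx] /eqP x1] | [/eqP-> /andP[Hh /eqP qh]]].
    by rewrite x1 Hh -(eqP fx) x1 morph1 !eqxx.
  by rewrite group1 Hh qh morph1 !eqxx.
have abZ : abelian Z by rewrite defZ morphim_abelian.
have cardZ : #|Z| = #|'ker q|.
  by rewrite defZ card_injm ?injm_pair1g ?subsetT.
pose Q := (E :&: fst @*^-1 P)%G.
have fstQ : fst @* Q = P.
  apply/setP=> x; apply/morphimP/idP=> [[z _ /setIP[_]] | Px].
    by rewrite !inE => Pz ->.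
  exists (x, s0 x); rewrite ?inE //= Px (subsetP sPG) //=.
  by rewrite qs0 // eqxx (subsetP ss0H) // mem_morphim.
have sZQ : Z \subset Q.
  by rewrite setIS // morphpreS ?sub1G.
have nsZE : Z <| E.
  rewrite /normal subsetIl normsI ?normG //.
  apply: subset_trans (subsetT E) _.
  exact: normal_norm (ker_normal (@fst_morphism gT hT)).
have sQE : Q \subset E := subsetIl _ _.
have iQ : #|E : Q| = #|G : P|.
  rewrite -fstE -fstQ.
  rewrite -(index_morphim_ker (@fst_morphism gT hT) sQE (subsetT _)).
  rewrite (_ : #|_ : Q| = 1%N) ?muln1 //.
  by apply/eqP; rewrite indexg_eq1.
have fM : {in P &, {morph (fun x => (x, s0 x)) : x y / x * y}}.
  by move=> x y Px Py; rewrite morphM.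
pose D := (Morphism fM @* P)%G.
have splitZ : [splits E, over Z].
  rewrite (Gaschutz_split nsZE sZQ) ?cardZ ?iQ //.
  apply/splitsP; exists D; apply/complP; split.
    apply/trivgP/subsetP=> z.
    case/setIP=> /setIP[_ /kerP z1] /morphimP[x _ Px def_z].
    by rewrite def_z /= in z1 *; rewrite inE (z1 _) ?inE // morph1.
  have sDQ : D \subset Q.
    apply/subsetP=> _ /morphimP[x _ Px ->]; rewrite !inE /= Px (subsetP sPG) //.
    by rewrite -qs0 // eqxx (subsetP ss0H) // mem_morphim.
  apply/eqP; rewrite eqEsubset mul_subG //=.
  apply/subsetP=> z Qz.
  have Pz : z.1 \in P by case/setIP: Qz => _; rewrite !inE.
  have Dz : (z.1, s0 z.1) \in D by apply/morphimP; exists z.1.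
  have Ez : (z.1, s0 z.1) \in E := subsetP sQE _ (subsetP sDQ _ Dz).
  rewrite -(mulgKV (z.1, s0 z.1) z) mem_mulg //.
  have Ew := groupM (subsetP sQE z Qz) (groupVr Ez).
  rewrite inE Ew; apply/kerP; first by rewrite inE.
  by rewrite /= mulgV.
(* The complement C is the graph of the lift. *)
case/splitsP: splitZ => C /complP[tiZC mulZC].
have sCE : C \subset E by rewrite -mulZC mulG_subr.
have injC : 'injm (restrm (subsetT C) (@fst gT hT)).
  rewrite ker_restrm; apply/subsetP=> z /setIP[Cz kz]; rewrite -tiZC.
  do 2![apply/setIP; split=> //]; exact: (subsetP sCE).
have fstC : restrm (subsetT C) (@fst gT hT) @* C = G.
  rewrite restrmEsub // -fstE -mulZC morphimMl ?subsetT //.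
  rewrite (_ : _ @* Z = 1) ?mul1g //.
  by apply/trivgP; rewrite sub_morphim_pre ?subsetT // subsetIr.
have sM : {in G &, {morph (fun x => (invm injC x).2) : x y / x * y}}.
  by move=> x y Gx Gy; rewrite morphM ?fstC.
pose s := Morphism sM.
have key x : x \in G -> exists2 z, z \in C & x = z.1 /\ s x = z.2.
  rewrite -{1}fstC => /morphimP[z _ Cz def_x]; exists z => //; split=> //.
  by rewrite /= def_x invmE.
exists s; split.
  apply/subsetP=> _ /morphimP[x _ /key[z Cz [_ ->]] ->].
  by have [] := memE z (subsetP sCE z Cz).
move=> _ /key[z Cz [-> ->]].
by have [] := memE z (subsetP sCE z Cz).
Qed.

(** * Existence of normal p-complements *)

(** Tate's theorem.  If X is not a p'-group, put R = (X :&: P)'.  The projection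
    from P onto P / R lifts the restriction to P of G -> G / X through
    P / R -> P / X = G / X, whose kernel (X :&: P) / R is abelian, so
    [Gaschutz_lift] lifts G -> G / X to a morphism s from G to P / R.  Its
    kernel is contained in X and has p-power index, and it cannot be X itself:
    the image of s would then be a proper supplement in P / R of the nontrivial
    subgroup (X :&: P) / R of the Frattini subgroup.  Hence 'ker s can replace
    X, and iterating this shrinks X to a p'-group, which is the required
    complement. *)
Lemma Tate_normal_complement (gT : finGroupType) (G X P : {group gT}) p :
    p.-Sylow(G) P -> X <| G -> p.-group (G / X) -> X :&: P \subset 'Phi(P) ->
  'O_p^'(G) ><| P = G.
Proof.
move=> sylP; have [sPG pP _] := and3P sylP.
have [m leXm] := ubnP #|X|; elim: m X => // m IHm X in leXm * => nsXG pGX sPhi.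
have [sXG nXG] := andP nsXG; have nXP := subset_trans sPG nXG.
have sGXP : G / X = P / X.
  by symmetry; apply: pHall_id (quotient_pHall nXP sylP) pGX.
have [tiXP | ntXP] := eqVneq (X :&: P) 1.
  have sdG : X ><| P = G.
    rewrite sdprodE //; apply/eqP; rewrite eqEsubset mul_subG //=.
    by rewrite -quotientSK // sGXP.
  rewrite (normal_Hall_pcore _ nsXG) //.
  by apply/(sdprod_normal_pHallP nsXG sylP).
pose R := ((X :&: P)^`(1))%G.
have nsIP : X :&: P <| P by rewrite setIC (normalGI sPG nsXG).
have nsRP : R <| P := char_normal_trans (der_char 1 _) nsIP.
have nRP := normal_norm nsRP.
have kR : 'ker (coset R) \subset 'ker (restrm nXP (coset X)).
  by rewrite ker_coset ker_restrm ker_coset setIC der_sub.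
pose q := [morphism of factm kR nRP].
have kq : 'ker q = (X :&: P) / R.
  by rewrite ker_factm ker_restrm ker_coset setIC.
have qE : {in P, forall x, q (coset R x) = coset X x}.
  by move=> x Px; apply: (factmE kR nRP).
have [|||||s [sH sE]] := @Gaschutz_lift _ _ _ G P _
  (restrm nXG (coset X)) q (restrm nRP (coset R)) sPG.
- rewrite morphim_factm !morphim_restrm !setIid.
  by rewrite -[coset X @* G]/(G / X) sGXP.
- by rewrite morphim_restrm setIid.
- exact: qE.
- by rewrite kq sub_der1_abelian.
- have pXP : p.-group (X :&: P) := pgroupS (subsetIr X P) pP.
  rewrite kq; apply: pnat_coprime (quotient_pgroup _ pXP) _.
  by case/and3P: sylP.
have sX x : x \in G -> q (s x) = 1 -> x \in X.
  move=> Gx; rewrite (sE x Gx) => /coset_idr-> //; exact: (subsetP nXG).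
have nsYG : 'ker s <| G := ker_normal s.
have sYX : 'ker s \subset X.
  by apply/subsetP=> x Kx; rewrite sX ?(dom_ker Kx) // (mker Kx) morph1.
have pGY : p.-group (G / 'ker s).
  rewrite (isog_pgroup _ (first_isog s)) (pgroupS sH) //.
  exact: quotient_pgroup.
have [eqYX | neqYX] := eqVneq ('ker s) X; last first.
  apply: IHm nsYG pGY _; last by apply: subset_trans sPhi; rewrite setSI.
  rewrite -ltnS (leq_trans _ leXm) // ltnS proper_card //.
  by rewrite properEneq neqYX.
have tis : s @* G :&: 'ker q = 1.
  apply/trivgP/subsetP=> _ /setIP[/morphimP[x _ Gx ->] Kx]; rewrite inE.
  by apply/eqP/mker; rewrite eqYX sX // (mker Kx).
have genP : s @* G = P / R.
  apply/eqP; rewrite eqEsubset sH /=; rewrite -[s @* G]genGid.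
  rewrite (@Phi_nongen _ (P / R)%G (s @* G)) //.
  apply/eqP; rewrite eqEsubset join_subG Phi_sub sH /=.
  (* In P / R, the element s x differs from the coset of x by an element of
     'ker q, hence of the Frattini subgroup. *)
  apply/subsetP=> _ /morphimP[x _ Px ->].
  have Gx := subsetP sPG x Px.
  have sxH : s x \in P / R by rewrite (subsetP sH) ?mem_morphim.
  have xH : coset R x \in P / R by rewrite mem_quotient.
  rewrite /= -(mulgKV (s x) (coset R x)).
  apply: groupM; last by rewrite mem_gen // inE mem_morphim ?orbT.
  rewrite mem_gen // inE; apply/orP; left.
  rewrite -(quotient_Phi pP nRP).
  apply: (subsetP (quotientS R sPhi)); rewrite -kq.
  apply/kerP; first by rewrite groupM ?groupV.
  by rewrite morphM ?morphV ?groupV // qE // sE // mulgV.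
case/eqP: ntXP; apply/trivgP.
have: (X :&: P) / R \subset [1 coset_of R].
  by rewrite -tis genP subsetI kq subxx quotientS ?subsetIr.
rewrite (quotient_sub1 (subset_trans (subsetIr X P) nRP)) => sIR.
have := nilpotent_sol (pgroup_nil (pgroupS (subsetIr X P) pP)).
move/sol_der1_proper=> /(_ _ (subxx _)); rewrite properE sIR andbF => H.
by apply: contraT => nt; apply: H; rewrite -subG1.
Qed.

(** Both P and P :^ g centralize x ^ g, so they are Sylow subgroups of its
    centralizer, in which they are therefore conjugate. *)
Lemma Burnside_fusion (gT : finGroupType) (G P : {group gT}) p x g :
    p.-Sylow(G) P -> abelian P -> x \in P -> g \in G -> x ^ g \in P ->
  exists2 n, n \in 'N_G(P) & x ^ g = x ^ n.
Proof.
move=> sylP abP Px Gg Pxg; have sPG := pHall_sub sylP.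
have sPC : P \subset 'C_G[x ^ g].
  by rewrite subsetI sPG sub_cent1 (subsetP abP).
have sPgC : P :^ g \subset 'C_G[x ^ g].
  rewrite subsetI conj_subG // cent1J conjSg.
  by rewrite sub_cent1 (subsetP abP).
have sC := subsetIl G 'C[x ^ g].
have sylPC := pHall_subl sPC sC sylP.
have sylPgC : p.-Sylow('C_G[x ^ g]) (P :^ g).
  by apply: pHall_subl sPgC sC _; rewrite pHallJ.
have [c /setIP[Gc /cent1P cxg] defP] := Sylow_trans sylPgC sylPC.
exists (g * c); last by rewrite conjgM /conjg -cxg mulKg.
by rewrite inE groupM //=; apply/normP; rewrite conjsgM -defP.
Qed.

(** Since P is central in its normalizer, [Burnside_fusion] shows that no two
    distinct elements of P are conjugate in G, so the transfer from G to P
    raises elements of P to the power |G : P|, which is prime to |P|.  The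
    kernel of the transfer thus meets P trivially, and it complements P by
    cardinality. *)
Lemma Burnside_normal_complement (gT : finGroupType) (G P : {group gT}) p :
  p.-Sylow(G) P -> 'N_G(P) \subset 'C(P) -> 'O_p^'(G) ><| P = G.
Proof.
move=> sylP cPN; have [sPG pP _] := and3P sylP.
have abP : abelian P by apply: subset_trans cPN; rewrite subsetI sPG normG.
(* The transfer lives in the additive module of the image of idm P, which is
   equal but not convertible to P. *)
have PI : idm P @* P = P by apply: morphim_idm.
have abI : abelian (idm P @* P) by rewrite PI.
pose V := [morphism of transfer G abI].
have VP : {in P, forall x, V x = FiniteModule.fmod abI (x ^+ #|G : P|)}.
  move=> g Pg; have Gg := subsetP sPG g Pg.
  pose X := transversal (rcosets P G :* <[g]>) G.
  have trX : is_transversal X (rcosets P G :* <[g]>) G.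
    exact: transversalP (rcosets_cycle_partition sPG Gg).
  have Ig : g \in idm P @* P by rewrite PI.
  have sXG := transversal_sub trX.
  rewrite /V /= (transfer_cycle_expansion sPG abI Gg trX) /=.
  transitivity (\sum_(x in X) FiniteModule.fmod abI (g ^+ #|<[g]> : P :* x|))%R.
    apply: eq_bigr => x Xx; have Gx := subsetP sXG x Xx.
    set n := #|_ : _|.
    have Pgn : (g ^+ n) ^ x^-1 \in P.
      have := mulg_exp_card_rcosets P g x.
      by rewrite mem_rcoset conjgE invgK mulgA.
    have Pn : g ^+ n \in P by rewrite groupX.
    have [y Ny ->] := Burnside_fusion sylP abP Pn (groupVr Gx) Pgn.
    by rewrite /restrm /= conjgE -(centP (subsetP cPN y Ny) _ Pn) mulKg.
  rewrite -(sum_index_rcosets_cycle sPG Gg trX) (FiniteModule.fmodX abI) //.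
  rewrite -GRing.sumrMnr.
  by apply: eq_bigr => x _; rewrite (FiniteModule.fmodX abI).
have coP : coprime #|P| #|G : P| by case/andP: (pHall_Hall sylP).
have tiKP : 'ker V :&: P = 1.
  apply/trivgP/subsetP=> x /setIP[Kx Px]; rewrite inE -order_eq1 -dvdn1.
  have Ixm : x ^+ #|G : P| \in idm P @* P by rewrite PI groupX.
  rewrite -(eqP coP) dvdn_gcd order_dvdG //= order_dvdn.
  have := mker Kx; rewrite VP // => Vx1.
  have /injmP inj := FiniteModule.injm_fmod abI.
  by apply/eqP; apply: inj; rewrite ?group1 // morph1.
have cardV : #|V @* G| <= #|P|.
  rewrite -(card_imset _ (@FiniteModule.fmod_inj _ _ abI)) subset_leq_card //.
  apply/subsetP=> _ /imsetP[u _ ->].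
  have: FiniteModule.fmval u \in idm P @* P := FiniteModule.fmodP u.
  by move: (FiniteModule.fmval u) => x; rewrite PI.
have defG : 'ker V * P = G.
  apply/eqP; rewrite eqEcard mul_subG ?subsetIl //= TI_cardMg //.
  rewrite -(Lagrange (subsetIl G _ : 'ker V \subset G)) leq_mul2l.
  by move: cardV; rewrite card_morphim setIid => ->; rewrite orbT.
have nsK : 'ker V <| G := ker_normal V.
have sdG : 'ker V ><| P = G.
  by rewrite sdprodE // (subset_trans sPG) ?normal_norm.
rewrite (normal_Hall_pcore _ nsK) //.
by apply/(sdprod_normal_pHallP nsK sylP).
Qed.

(** Modulo L the Sylow subgroup P becomes abelian and remains self-normalizing,
    hence central in its normalizer, so Burnside's theorem applies to M / L;
    the condition on L :&: P lets Tate's theorem lift the conclusion to M. *)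
Lemma self_normalizing_normal_complement (gT : finGroupType)
    (M L P : {group gT}) p :
    p.-Sylow(M) P -> 'N_M(P) = P -> L <| M ->
    P^`(1) \subset L -> L :&: P \subset 'Phi(P) ->
  'O_p^'(M) ><| P = M.
Proof.
move=> sylP defNP nsLM sP'L sLPPhi; have [sPM pP _] := and3P sylP.
have [sLM nLM] := andP nsLM; have nLP := subset_trans sPM nLM.
have defPL : P / L = (P <*> L) / L by rewrite quotientYidr.
have nsLPL : L <| P <*> L by rewrite normalYr.
(* A Frattini argument inside the normalizer of P <*> L. *)
have sBPL : 'N_M(P <*> L) \subset P <*> L.
  have sPLM : P <*> L \subset M by rewrite join_subG sPM.
  have nsPLB : (P <*> L)%G <| 'N_M(P <*> L)%G by apply: normalSG.
  have sylPL : p.-Sylow(P <*> L) P.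
    exact: pHall_subl (joing_subl P L) sPLM sylP.
  rewrite -(Frattini_arg nsPLB sylPL) mul_subG //.
  apply: subset_trans (joing_subl P L).
  by rewrite -{3}defNP setSI // subsetIl.
have abPL : abelian (P / L) by apply: sub_der1_abelian.
have sdML : 'O_p^'(M / L) ><| (P / L) = M / L.
  apply: (Burnside_normal_complement (quotient_pHall nLP sylP)).
  apply: subset_trans abPL; rewrite /= {1}defPL -quotient_subnormG // defPL.
  exact: quotientS.
have [X defX sLX nsXM] := inv_quotientN nsLM (pcore_normal p^' (M / L)).
have [_ _ _ tiOP] := sdprodP sdML.
apply: (Tate_normal_complement sylP nsXM).
  rewrite /pgroup card_quotient ?normal_norm //.
  rewrite -(index_quotient_eq _ (normal_sub nsXM) nLM) ?subIset ?sLX ?orbT //.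
  rewrite -defX -divgS ?pcore_sub //= -(sdprod_card sdML) mulKn //.
  exact: quotient_pgroup.
apply: subset_trans sLPPhi; rewrite subsetI subsetIr andbT.
rewrite -quotient_sub1 ?(subset_trans (subsetIr X P) nLP) // -tiOP defX.
by rewrite subsetI !quotientS ?subsetIl ?subsetIr.
Qed.

Import GRing.Theory Num.Theory.
Local Open Scope ring_scope.

(** * Characters *)

(** Ito's theorem.  A constituent t of the restriction to A is linear.  By
    Clifford's correspondence, chi_i is induced from some chi_s of the inertia
    group T of t, lying over t; as t is T-invariant, chi_s restricts to A as a
    multiple of t, so A is contained in the centre of chi_s and chi_s(1)
    divides |T : A|. *)
Lemma Ito_dvd_index (gT : finGroupType) (G A : {group gT}) i :
    (A <| G)%g -> (A^`(1) \subset cfker 'chi[G]_i)%g ->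
  ('chi_i 1%g %| #|G : A|%g%:R)%C.
Proof.
move=> nsAG kerA'; have [sAG nAG] := andP nsAG.
have [t chi_t] := constt_cfRes_irr A i.
have lin_t : 'chi_t \is a linear_char.
  rewrite lin_irr_der1; apply: subset_trans (cfker_constt _ chi_t); last first.
    by rewrite cfRes_char ?irr_char.
  by rewrite cfker_Res ?irr_char // subsetI der_sub.
set T := 'I_G['chi_t]%G.
have nsAT : (A <| T)%g := normal_Inertia 'chi_t sAG.
have sTG : T \subset G := Inertia_sub _ _.
have [irrInd _ AtoB _ _] := constt_Inertia_bijection t nsAG.
have: i \in irr_constt ('Ind[G] 'chi_t) by rewrite constt_Ind_Res.
rewrite -AtoB => /imsetP[s Ts ->].
rewrite cfIirrE ?irrInd // cfInd1 //.
rewrite -(Lagrange_index sTG (normal_sub nsAT)) natrM.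
have sAZ : A \subset ('Z('chi_s))%CF.
  rewrite constt_Ind_Res in Ts.
  have defA := Clifford_Res_sum_cfclass nsAT Ts.
  rewrite cfclass_invariant ?subsetIr // big_seq1 in defA.
  have sAT := normal_sub nsAT.
  apply/subsetP=> x Ax; rewrite irr_cfcenterE ?(subsetP sAT) //.
  rewrite -(cfResE _ sAT) // -(cfRes1 A) defA !cfunE normrM lin_char1 //.
  rewrite normC_lin_char // ger0_norm //.
  by rewrite natr_ge0 ?Cnat_cfdot_char ?cfRes_char ?irr_char.
have /natrP[m dm] := Cnat_irr1 s; rewrite dm.
have: (m %| #|T : 'Z('chi_s)%CF|%g)%N.
  by have := dvd_irr1_index_center s; rewrite dm dvdC_nat.
move/dvdn_trans/(_ (indexgS T sAZ)) => dv_m.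
by rewrite -!natrM dvdC_nat dvdn_mul.
Qed.

(** The kernel of an extension of chi_i meets N in cfker chi_i, and the
    irreducible characters of N with Q in their kernel are those of N / Q, so
    that their kernels intersect in Q. *)
Lemma normal_subgroup_of_extensions (gT : finGroupType) (G N Q : {group gT}) :
    (N \subset G)%g -> (Q <| N)%g ->
    (forall i : Iirr N, Q \subset cfker 'chi_i -> extends_to G 'chi_i) ->
  exists2 L : {group gT}, (L <| G)%g & (L :&: N = Q)%g.
Proof.
move=> sNG nsQN ext.
have ex i : exists L : {group gT}, (L <| G)%g /\
   (Q \subset cfker 'chi[N]_i -> N :&: L = cfker 'chi_i)%g.
  case kQ: (Q \subset cfker 'chi_i); last by exists G.
  have [chi Nchi defi] := ext i kQ.
  by exists [group of cfker chi]; rewrite cfker_normal -defi cfker_Res.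
have [L nsLG] := fin_all_exists ex.
exists [group of (G :&: \bigcap_(i | Q \subset cfker 'chi[N]_i) L i)%g].
  rewrite /normal subsetIl /=.
  rewrite normsI ?normG // norms_bigcap //.
  apply/bigcapsP=> i _; by have [/andP[]] := nsLG i.
apply: etrans (cap_cfker_normal nsQN) => /=.
apply/setP=> x; rewrite !inE; apply/andP/bigcapP.
  case=> /andP[_ /bigcapP Lx] Nx i kQ.
  by have [_ <-] := nsLG i; rewrite // inE Nx Lx.
move=> kx; have Nx : x \in N.
  by apply: subsetP (kx 0 _); rewrite ?cfker_sub ?cfker_irr0 ?normal_sub.
rewrite Nx (subsetP sNG) //; split=> //; apply/bigcapP=> i kQ.
by have := kx i kQ; have [_ <-] := nsLG i; rewrite // => /setIP[].
Qed.

(** * Extension from the Sylow normalizer *)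

Theorem theoremC (gT : finGroupType) (G P : {group gT}) (p : nat)
    (p_prime : prime p) (sylP : (p.-Sylow(G) P)%g) :
  (forall i : Iirr 'N_G(P)%g,
      ~~ (p %| 'chi_i 1%g)%C -> extends_to G 'chi_i) <->
  (exists K : {group gT},
      [/\ (K <| G)%g, (K * 'N_G(P) = G :> {set gT})%g &
          ('N_K(P) = 1 :> {set gT})%g]).
Proof.
have [sPG pP _] := and3P sylP; have nsPN : (P <| 'N_G(P))%g := normalSG sPG.
split=> [ext | [K [nsKG defG tiKN]] i _]; last first.
  have tiKNG : (K :&: 'N_G(P) = 1)%g.
    by rewrite setIA (setIidPl (normal_sub nsKG)).
  have sdG : (K ><| 'N_G(P) = G)%g.
    by rewrite sdprodE // (subset_trans (subsetIl _ _) (normal_norm nsKG)).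
  exists (cfSdprod sdG 'chi_i); first by rewrite cfSdprod_char irr_char.
  exact: cfSdprodK.
(* Ito's theorem makes the hypothesis available for all of Irr(N / P'). *)
have extP' (Q : {group gT}) : (P^`(1) \subset Q -> Q <| 'N_G(P) ->
    exists2 L : {group gT}, L <| G & L :&: 'N_G(P) = Q)%g.
  move=> sP'Q nsQN.
  apply: normal_subgroup_of_extensions (subsetIl _ _) nsQN _ => i kQ.
  apply: ext; apply/negP=> p_chi.
  have := Ito_dvd_index nsPN (subset_trans sP'Q kQ).
  move/(dvdC_trans p_chi); rewrite dvdC_nat.
  have sylPN : (p.-Sylow('N_G(P)) P)%g by rewrite Sylow_subnorm.
  by case/and3P: sylPN => _ _; rewrite p'natE // => /negP.
have [M nsMG tiMN] := extP' P (der_sub 1 P) nsPN.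
have nsP'N : (P^`(1) <| 'N_G(P))%g := char_normal_trans (der_char 1 P) nsPN.
have [L0 nsL0G tiL0N] := extP' [group of P^`(1)%g] (subxx _) nsP'N.
(* L0 need not lie in M: the extensions defining L0 and M are unrelated. *)
pose L := (L0 :&: M)%G.
have sMG := normal_sub nsMG.
have sPM : P \subset M by rewrite -tiMN subsetIl.
have sylPM : (p.-Sylow(M) P)%g := pHall_subl sPM sMG sylP.
have defNP : ('N_M(P) = P)%g by rewrite -{2}tiMN setIA (setIidPl sMG).
have nsLM : (L <| M)%g.
  by apply: normalS (subsetIr _ _) sMG _; apply: normalI.
have sP'L : (P^`(1) \subset L)%g.
  by rewrite subsetI -{1}tiL0N subsetIl (subset_trans (der_sub 1 P)).
have sLPPhi : (L :&: P \subset 'Phi(P))%g.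
  rewrite (Phi_joing pP) (subset_trans _ (joing_subl _ _)) // -tiL0N.
  by rewrite setISS ?subsetIl // subsetI sPG normG.
have sdM := self_normalizing_normal_complement sylPM defNP nsLM sP'L sLPPhi.
have [_ defM _ _] := sdprodP sdM.
set K := ('O_p^'(M))%G.
have sKM : K \subset M := pcore_sub _ _.
exists K; split.
- exact: char_normal_trans (pcore_char _ _) nsMG.
- apply/eqP; rewrite eqEsubset mul_subG ?subsetIl ?(subset_trans sKM) //=.
  rewrite -{1}(Frattini_arg nsMG sylPM) -{1}defM -mulgA mulgS //.
  by rewrite mul_subG // subsetI sPG normG.
have sNKP : ('N_K(P) \subset P)%g by rewrite -{2}defNP setSI.
have p'K : (p^'.-group 'N_K(P))%g.
  exact: pgroupS (subsetIl _ _) (pcore_pgroup _ _).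
apply/eqP; rewrite trivg_card1; apply/eqP.
exact: pnat_1 (pgroupS sNKP pP) p'K.
Qed.
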